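(* Let $0<\sigma\le\beta<\infty$, $0<\theta\le\zeta<\infty$ and $\gamma\in(0,\infty)$. Put $\hat\beta=\frac{\zeta^2}{\sigma}$, $\hat\sigma=\frac{\theta^2}{\beta}$ and $$\hat\delta=\max\left(\frac{\gamma\hat\beta-1}{1+\gamma\hat\beta},\frac{1-\gamma\hat\sigma}{1+\gamma\hat\sigma}\right).$$ Consider the class of problems of minimizing $f(x)+g(y)$ subject to $\mathcal{A}x+\mathcal{B}y=c$, where $f$ and $g$ are proper, closed, convex on real Hilbert spaces $\mathcal{H}_1$ and $\mathcal{H}_2$, $f$ is $\beta$-smooth and $\sigma$-strongly convex, $\mathcal{A}:\mathcal{H}_1\to\mathcal{K}$ and $\mathcal{B}:\mathcal{H}_2\to\mathcal{K}$ are bounded linear operators into a real Hilbert space $\mathcal{K}$, $c\in\mathcal{K}$, $\mathcal{A}$ is surjective, $\|\mathcal{A}^*\|=\zeta$, and $\|\mathcal{A}^*\mu\|\ge\theta\|\mu\|$ for all $\mu\in\mathcal{K}$, and such that $d_1(\mu)=f^*(-\mathcal{A}^*\mu)+\langle c,\mu\rangle$ and $d_2(\mu)=g^*(-\mathcal{B}^*\mu)$ are proper, closed and convex on $\mathcal{K}$. Consider the iteration $$z^{k+1}=\big((1-\alpha)\mathrm{Id}+\alpha R_{\gamma d_1}R_{\gamma d_2}\big)z^k$$ (equivalently, ADMM applied to the primal problem). (1) For every $\alpha\in\left(0,\frac{2}{1+\hat\delta}\right)$, the rate bound $\|z^{k+1}-\bar z\|\le(|1-\alpha|+\alpha\hat\delta)\|z^k-\bar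 z\|$ (with $\bar z$ a fixed point of $R_{\gamma d_1}R_{\gamma d_2}$) is tight for this class: there exist a problem in the class, a fixed point $\bar z$ of $R_{\gamma d_1}R_{\gamma d_2}$ and a starting point $z^0\neq\bar z$ such that $\|z^{k+1}-\bar z\|=(|1-\alpha|+\alpha\hat\delta)\|z^k-\bar z\|$ for all $k\ge0$. (2) For every real $\alpha\notin\left(0,\frac{2}{1+\hat\delta}\right)$, there exists a problem in the class that the algorithm does not solve: for some starting point $z^0$, the sequence $(z^k)$ does not converge to a fixed point of $R_{\gamma d_1}R_{\gamma d_2}$.
   Context: For a proper, closed, convex $h$ on a real Hilbert space and $\gamma>0$: $\mathrm{prox}_{\gamma h}(z)=\operatorname{argmin}_x\{\gamma h(x)+\frac12\|x-z\|^2\}$ and $R_{\gamma h}=2\,\mathrm{prox}_{\gamma h}-\mathrm{Id}$. The conjugate is $h^*(y)=\sup_x\{\langle y,x\rangle-h(x)\}$; $\mathcal{A}^*$ denotes the adjoint. $f$ is $\sigma$-strongly convex if $f-\frac{\sigma}{2}\|\cdot\|^2$ is convex, and $\beta$-smooth if it is differentiable and $\frac{\beta}{2}\|\cdot\|^2-f$ is convex. ADMM (with relaxation $\alpha$ and scaled dual variable $u$) is the iteration $x^{k+1}=\operatorname{argmin}_x\{f(x)+\frac{\gamma}{2}\|\mathcal{A}x+\mathcal{B}y^k-c+u^k\|^2\}$, $x_A^{k+1}=2\alpha\mathcal{A}x^{k+1}-(1-2\alpha)(\mathcal{B}y^k-c)$, $y^{k+1}=\operatorname{argmin}_y\{g(y)+\frac{\gamma}{2}\|x_A^{k+1}+\mathcal{B}y-c+u^k\|^2\}$,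 $u^{k+1}=u^k+(x_A^{k+1}+\mathcal{B}y^{k+1}-c)$; it is identified with the $z$-iteration through $z^k=\gamma(u^k-\mathcal{B}y^k)$. *)

(* Defs.v *)
From HB Require Import structures.
From mathcomp Require Import all_boot all_order all_algebra.
From mathcomp Require Import all_classical all_reals all_analysis.

Set Implicit Arguments.
Unset Strict Implicit.
Unset Printing Implicit Defensive.

Import Order.TTheory GRing.Theory Num.Theory.
Import numFieldNormedType.Exports.

Local Open Scope classical_set_scope.
Local Open Scope ring_scope.

(* A real Hilbert space is a complete normed space whose norm comes from an
   inner product; positive definiteness follows from [innerxx]. *)
HB.mixin Record CompleteNormedModule_isHilbert (R : realType) V
    & CompleteNormedModule R V := {
  inner : V -> V -> R ;
  innerC : forall x y, inner x y = inner y x ;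
  innerDl : forall x y z, inner (x + y) z = inner x z + inner y z ;
  innerZl : forall a x y, inner (a *: x) y = a * inner x y ;
  innerxx : forall x, inner x x = `|x| ^+ 2
}.

#[short(type="hilbertType")]
HB.structure Definition Hilbert (R : realType) :=
  {V of CompleteNormedModule R V & CompleteNormedModule_isHilbert R V}.

Section convex_analysis.
Context {R : realType} {H : hilbertType R}.
Implicit Types (f h : H -> \bar R) (x y z : H).

Definition proper f :=
  (exists x, (f x < +oo)%E) /\ (forall x, (-oo < f x)%E).

(* The second component ranges over the reals only, as usual for epigraphs
   of extended-valued functions. *)
Definition epigraph f : set (H * R^o) := [set p | (f p.1 <= (p.2 : R)%:E)%E].

Definition closed_fun f := closed (epigraph f).

Definition convex_fun f :=
  convex_set (epigraph f : set (convex_lmodType (H * R^o)%type)).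

Definition pcc f := [/\ proper f, closed_fun f & convex_fun f].

Definition strongly_convex (sigma : R) f :=
  convex_fun (fun x => f x - (sigma / 2 * `|x| ^+ 2)%:E)%E.

(* Differentiability (in the sense of Frechet) forces f to be real-valued. *)
Definition smooth (beta : R) f :=
  (exists phi : H -> R^o,
     (forall x, f x = (phi x : R)%:E) /\ (forall x, differentiable phi x)) /\
  convex_fun (fun x => (beta / 2 * `|x| ^+ 2)%:E - f x)%E.

Definition argmin f : set H := [set x | forall y, (f x <= f y)%E].

(* For h proper, closed and convex the argmin is a singleton; the default
   value 0 is only used when it is empty. *)
Definition prox (gamma : R) h z : H :=
  xget 0 (argmin (fun x => gamma%:E * h x + (2^-1 * `|x - z| ^+ 2)%:E)%E).

Definition reflected_prox (gamma : R) h z : H := 2 *: prox gamma h z - z.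

Definition conjugate f y : \bar R :=
  ereal_sup (range (fun x => (inner y x)%:E - f x)%E).

End convex_analysis.

Section operators.
Context {R : realType} {H K : hilbertType R}.

Definition bounded_operator (T : H -> K) :=
  exists M : R, forall x, `|T x| <= M * `|x|.

(* Only the bound over the unit ball of a bounded operator is meaningful:
   [sup] is 0 on unbounded sets. *)
Definition opnorm (T : H -> K) : R :=
  sup [set `|T x| | x in [set x : H | `|x| <= 1]].

(* For T linear and bounded, the vector v below exists (Riesz) and is unique. *)
Definition adjoint (T : H -> K) (mu : K) : H :=
  xget 0 [set v | forall x, inner (T x) mu = inner x v].

End operators.

(* Data of: minimize primal_f x + primal_g y subject to opA x + opB y = rhs. *)
Record problem (R : realType) := Problem {
  spaceH1 : hilbertType R ;
  spaceH2 : hilbertType R ;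
  spaceK : hilbertType R ;
  primal_f : spaceH1 -> \bar R ;
  primal_g : spaceH2 -> \bar R ;
  opA : {linear spaceH1 -> spaceK} ;
  opB : {linear spaceH2 -> spaceK} ;
  rhs : spaceK
}.

Arguments primal_f {R} P _ : rename.
Arguments primal_g {R} P _ : rename.

Section admm.
Context {R : realType}.
Implicit Types (P : problem R) (alpha gamma : R).

Definition d1 P (mu : spaceK P) : \bar R :=
  (conjugate (primal_f P) (- adjoint (opA P) mu)%R + (inner (rhs P) mu)%:E)%E.

Definition d2 P (mu : spaceK P) : \bar R :=
  conjugate (primal_g P) (- adjoint (opB P) mu).

Arguments d1 : clear implicits.
Arguments d2 : clear implicits.

Definition problem_class (sigma beta theta zeta : R) P : Prop :=
  [/\ [/\ pcc (primal_f P), pcc (primal_g P),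
          smooth beta (primal_f P) & strongly_convex sigma (primal_f P)],
      bounded_operator (opA P) /\ bounded_operator (opB P),
      [/\ forall mu : spaceK P, exists x, opA P x = mu,
          opnorm (adjoint (opA P)) = zeta
        & forall mu : spaceK P, theta * `|mu| <= `|adjoint (opA P) mu|]
    & pcc (d1 P) /\ pcc (d2 P)].

Definition RR gamma P (z : spaceK P) : spaceK P :=
  reflected_prox gamma (d1 P) (reflected_prox gamma (d2 P) z).

Definition fixed_point gamma P (z : spaceK P) : Prop := RR gamma z = z.

Definition z_iteration alpha gamma P (z : nat -> spaceK P) : Prop :=
  forall k, z k.+1 = (1 - alpha) *: z k + alpha *: RR gamma (z k).

(* Sequences generated by relaxed ADMM; the value of x at 0 is irrelevant. *)
Definition admm alpha gamma P
    (x : nat -> spaceH1 P) (y : nat -> spaceH2 P) (u : nat -> spaceK P) : Prop :=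
  forall k,
    let xA := (2 * alpha) *: opA P (x k.+1)
              - (1 - 2 * alpha) *: (opB P (y k) - rhs P) in
    [/\ argmin (fun v => primal_f P v +
          (gamma / 2 * `|opA P v + opB P (y k) - rhs P + u k| ^+ 2)%:E)%E (x k.+1),
        argmin (fun w => primal_g P w +
          (gamma / 2 * `|xA + opB P w - rhs P + u k| ^+ 2)%:E)%E (y k.+1)
      & u k.+1 = u k + (xA + opB P (y k.+1) - rhs P)].

(* The sequence z is the one identified with some run of ADMM on P. *)
Definition admm_run alpha gamma P (z : nat -> spaceK P) : Prop :=
  exists x y u, admm alpha gamma x y u /\
    forall k, z k = gamma *: (u k - opB P (y k)).

End admm.

(* Main.v *)
Require Import Defs.
From HB Require Import structures.
From mathcomp Require Import all_boot all_order all_algebra.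
From mathcomp Require Import all_classical all_reals all_analysis.
From mathcomp Require Import ring lra.

(** Both claims reduce to a linear iteration in the Euclidean plane. Take all
    three spaces equal to the plane, A = diag(zeta, theta), B = Id, c = 0 and
    f(x) = (sigma x_1^2 + beta x_2^2) / 2. Pairing zeta with sigma and theta
    with beta gives d_1 the two extreme curvatures that the class allows:
    d_1(mu) = (betahat mu_1^2 + sigmahat mu_2^2) / 2 with betahat = zeta^2/sigma
    and sigmahat = theta^2/beta, so that R_{gamma d_1} = diag(kappa_1, kappa_2)
    with kappa_1 = (1 - gamma betahat)/(1 + gamma betahat) and kappa_2 =
    (1 - gamma sigmahat)/(1 + gamma sigmahat). A line would not do when
    theta < zeta: there |A^* mu| = zeta |mu| for all mu, and the curvature
    sigmahat does not occur.

    The function g is either 0 or the indicator of the origin. These are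
    conjugate to each other, so d_2 is the other one, and R_{gamma d_2} is -Id
    or Id ([RR_witness]): the choice of g is the choice of a sign in front of
    diag(kappa_1, kappa_2). Since deltahat = max(-kappa_1, kappa_2),
    either of deltahat and -deltahat can be made an eigenvalue of
    R_{gamma d_1} R_{gamma d_2} with a basis vector e as eigenvector, and then
    z^k = rho^k e with rho = 1 - alpha + alpha deltahat or
    rho = 1 - alpha - alpha deltahat ([geometric_run]). The origin is the only
    fixed point because |kappa_i| < 1 ([fixed_point_witness]).

    For alpha > 0, the sign that makes the terms of rho add up (plus for
    alpha <= 1, minus for alpha > 1) gives |rho| = |1 - alpha| + alpha deltahat,
    which is tightness. For alpha <= 0 the plus sign, and for
    alpha >= 2/(1 + deltahat) the minus sign, gives |rho| >= 1, and rho^k e does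
    not tend to the only fixed point.

    Every such z comes from a run of ADMM ([admm_run_witness]): when g is the
    indicator of the origin, y vanishes and u carries z / gamma; when g = 0, the
    y-update annihilates the residual, so u vanishes and y carries
    -z / gamma. *)

Import Order.TTheory GRing.Theory Num.Theory.
Import numFieldNormedType.Exports.

Local Open Scope classical_set_scope.
Local Open Scope ring_scope.

Set Implicit Arguments.
Unset Strict Implicit.
Unset Printing Implicit Defensive.

(** * The Euclidean plane as a Hilbert space *)

Section euclidean_plane.
Context (R : realType).

(** The product of two lines carries the maximum norm; the alias receives the
    Euclidean norm instead, on the same module structure. *)
Definition plane : Type := (R^o * R^o)%type.

HB.instance Definition _ := GRing.Lmodule.copy plane (R^o * R^o)%type.

Definition plane_inner (x y : plane) : R := x.1 * y.1 + x.2 * y.2.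

Definition plane_norm (x : plane) : R := Num.sqrt (plane_inner x x).

Lemma plane_inner_ge0 x : 0 <= plane_inner x x.
Proof. by rewrite addr_ge0 // -expr2 sqr_ge0. Qed.

Lemma plane_normK x : plane_norm x ^+ 2 = plane_inner x x.
Proof. by rewrite sqr_sqrtr ?plane_inner_ge0. Qed.

Lemma plane_normD x y : plane_norm (x + y) <= plane_norm x + plane_norm y.
Proof.
have x0 : 0 <= plane_norm x := sqrtr_ge0 _.
have y0 : 0 <= plane_norm y := sqrtr_ge0 _.
rewrite -(@ler_pXn2r _ 2) ?nnegrE ?sqrtr_ge0 ?addr_ge0 // sqrrD !plane_normK.
(* Cauchy-Schwarz, from Lagrange's identity *)
have CS : plane_inner x y <= plane_norm x * plane_norm y.
  rewrite -sqrtrM ?plane_inner_ge0 // (le_trans (ler_norm _)) // -sqrtr_sqr.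
  rewrite ler_wsqrtr // /plane_inner.
  have := sqr_ge0 (x.1 * y.2 - x.2 * y.1); lra.
suff -> : plane_inner (x + y) (x + y) =
  plane_inner x x + plane_inner y y + plane_inner x y *+ 2 by lra.
rewrite /plane_inner /=; ring.
Qed.

Lemma plane_normZ (l : R) x : plane_norm (l *: x) = `|l| * plane_norm x.
Proof.
rewrite -sqrtr_sqr -sqrtrM ?sqr_ge0 //; congr Num.sqrt.
by rewrite /plane_inner /= /GRing.scale /=; ring.
Qed.

Lemma plane_norm_eq0 x : plane_norm x = 0 -> x = 0.
Proof.
move=> nx; have := plane_normK x; rewrite nx expr0n /= /plane_inner => /eqP.
rewrite eq_sym paddr_eq0 -?expr2 ?sqr_ge0 // !sqrf_eq0.
move=> /andP[/eqP x1 /eqP x2].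
by case: x x1 x2 {nx} => a b /= -> ->.
Qed.

HB.instance Definition _ := Lmodule_isNormed.Build R plane
  plane_normD plane_normZ plane_norm_eq0.

Lemma normr_fst_le (x : plane) : `|x.1| <= `|x|.
Proof.
rewrite -sqrtr_sqr; apply: ler_wsqrtr.
by rewrite /plane_inner -expr2 lerDl -expr2 sqr_ge0.
Qed.

Lemma normr_snd_le (x : plane) : `|x.2| <= `|x|.
Proof.
rewrite -sqrtr_sqr; apply: ler_wsqrtr.
by rewrite /plane_inner -!expr2 lerDr sqr_ge0.
Qed.

Lemma plane_norm_le (x : plane) : `|x| <= `|x.1| + `|x.2|.
Proof.
rewrite -(@ler_pXn2r _ 2) ?nnegrE ?addr_ge0 //.
rewrite [leLHS]plane_normK sqrrD !real_normK ?num_real // /plane_inner -!expr2.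
by have : 0 <= `|x.1| * `|x.2| by []; lra.
Qed.

(** The two coordinates are 1-Lipschitz, hence map a Cauchy filter to Cauchy
    filters of the line; the norm is at most the sum of the coordinates, so the
    limits of the coordinates form a limit. *)
Lemma plane_complete (F : set_system plane) :
  ProperFilter F -> cauchy F -> cvg F.
Proof.
move=> FF /cauchyP cF.
have coord_cvg (p : plane -> R^o) : (forall x y, `|p x - p y| <= `|x - y|) ->
    exists l : R^o, p @ F --> l.
  move=> p1; apply/cvg_ex/cauchy_cvgP/cauchyP => e e0.
  have [x Fx] := cF _ e0; exists (p x).
  rewrite /= nbhs_filterE /=; apply: filterS Fx => y.
  by rewrite -!ball_normE /=; apply: le_lt_trans.
have [l1 /cvgrPdist_lt c1] := coord_cvg _ (fun x y => normr_fst_le (x - y)).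
have [l2 /cvgrPdist_lt c2] := coord_cvg _ (fun x y => normr_snd_le (x - y)).
apply/cvg_ex; exists ((l1, l2) : plane); apply/cvgrPdist_lt => e e0.
have e20 : 0 < e / 2 by lra.
near=> x.
apply: (le_lt_trans (plane_norm_le _)) => /=.
have h1 : `|l1 - x.1| < e / 2 by near: x; exact: c1.
have h2 : `|l2 - x.2| < e / 2 by near: x; exact: c2.
lra.
Unshelve. all: by end_near. Qed.

HB.instance Definition _ := Uniform_isComplete.Build plane plane_complete.

Lemma plane_innerC x y : plane_inner x y = plane_inner y x.
Proof. by rewrite /plane_inner; ring. Qed.

Lemma plane_innerDl x y z :
  plane_inner (x + y) z = plane_inner x z + plane_inner y z.
Proof. by rewrite /plane_inner /=; ring. Qed.

Lemma plane_innerZl a x y : plane_inner (a *: x) y = a * plane_inner x y.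
Proof. by rewrite /plane_inner /= /GRing.scale /=; ring. Qed.

Lemma plane_innerxx x : plane_inner x x = `|x| ^+ 2.
Proof. by rewrite [RHS]plane_normK. Qed.

HB.instance Definition _ := CompleteNormedModule_isHilbert.Build R plane
  plane_innerC plane_innerDl plane_innerZl plane_innerxx.

Lemma innerE (x y : plane) : inner x y = x.1 * y.1 + x.2 * y.2.
Proof. by []. Qed.

Lemma plane_inj (x y : plane) : x.1 = y.1 -> x.2 = y.2 -> x = y.
Proof. by case: x y => [a b] [c d] /= -> ->. Qed.

End euclidean_plane.

(** * Real-valued convex functions and the indicator of the origin *)

Section finite_functions.
Context {R : realType} {H : hilbertType R} (phi : H -> R).

Lemma convex_fun_EFin :
  (forall t x y, 0 <= t <= 1 ->
    phi (t *: x + (1 - t) *: y) <= t * phi x + (1 - t) * phi y) ->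
  convex_fun (fun x => (phi x)%:E).
Proof.
move=> cphi [x a] [y b] t /[!inE] /=; rewrite /epigraph /= !lee_fin => xa yb.
have /andP[t0 t1] : 0 <= t%:num <= 1 by rewrite ge0 le1.
apply: (le_trans (cphi _ _ _ _)); first by rewrite t0.
apply: lerD; first exact: ler_wpM2l.
by apply: ler_wpM2l => //; rewrite subr_ge0.
Qed.

Lemma closed_fun_EFin :
  continuous (phi : H -> R^o) -> closed_fun (fun x => (phi x)%:E).
Proof.
move=> cphi; rewrite /closed_fun.
have -> : epigraph (fun x => (phi x)%:E) =
    (fun p : H * R^o => phi p.1 - p.2 : R^o) @^-1` [set r : R^o | r <= 0].
  by apply/seteqP; split=> -[x a] /=; rewrite /epigraph /= lee_fin subr_le0.
apply: closed_comp; last exact: closed_le.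
move=> p _; apply: (@cvgB _ R^o); last exact: cvg_snd.
by apply: (cvg_comp _ _ cvg_fst); exact: cphi.
Qed.

Lemma proper_EFin : Defs.proper (fun x => (phi x)%:E).
Proof. by split=> [|x]; [exists 0; rewrite ltry|rewrite ltNyr]. Qed.

End finite_functions.

Section indicator_zero.
Context {R : realType} {H : hilbertType R}.

Definition origin_indic (x : H) : \bar R := if x == 0 then 0%E else +oo%E.

Lemma origin_indic0 : origin_indic 0 = 0%E.
Proof. by rewrite /origin_indic eqxx. Qed.

Lemma origin_indic_neq0 x : x != 0 -> origin_indic x = +oo%E.
Proof. by rewrite /origin_indic => /negbTE ->. Qed.

Lemma epigraph_origin_indic :
  epigraph origin_indic = [set p | p.1 = 0 /\ 0 <= (p.2 : R)].
Proof.
apply/seteqP; split=> -[x a]; rewrite /epigraph /origin_indic /=;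
  case: eqP => [x0|x0].
- by rewrite lee_fin.
- by rewrite leye_eq.
- by rewrite lee_fin => -[].
- by case.
Qed.

Lemma pcc_origin_indic : pcc origin_indic.
Proof.
split.
- split; first by exists 0; rewrite origin_indic0.
  by move=> x; rewrite /origin_indic; case: ifP => _; rewrite ?ltNyr.
- rewrite /closed_fun epigraph_origin_indic.
  have -> : [set p : H * R^o | p.1 = 0 /\ 0 <= (p.2 : R)] =
     fst @^-1` [set 0] `&` snd @^-1` [set r : R^o | 0 <= r] by [].
  apply: closedI.
    apply: closed_comp => [p _|]; first exact: cvg_fst.
    exact/accessible_closed_set1/hausdorff_accessible/norm_hausdorff.
  apply: closed_comp => [p _|]; first exact: cvg_snd.
  exact: closed_ge.
- rewrite /convex_fun epigraph_origin_indic => -[x a] [y b] t /[!inE] /=.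
  move=> [x0 a0] [y0 b0]; split; first by rewrite x0 y0 !scaler0 addr0.
  by rewrite addr_ge0 // mulr_ge0 // subr_ge0 le1.
Qed.

End indicator_zero.

(** * Diagonal quadratic forms *)

Section quadratic.
Context (R : realType).
Implicit Types (p a x y z : plane R) (g : R).

Definition quadr p x : R := p.1 / 2 * x.1 ^+ 2 + p.2 / 2 * x.2 ^+ 2.
Definition quad p x : \bar R := (quadr p x)%:E.

Definition fst_plane x : R^o := x.1.
Definition snd_plane x : R^o := x.2.

Lemma fst_plane_linear : linear fst_plane. Proof. by []. Qed.
Lemma snd_plane_linear : linear snd_plane. Proof. by []. Qed.
HB.instance Definition _ :=
  GRing.isLinear.Build R (plane R) R^o _ fst_plane fst_plane_linear.
HB.instance Definition _ :=
  GRing.isLinear.Build R (plane R) R^o _ snd_plane snd_plane_linear.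

Lemma contraction_differentiable (T : {linear plane R -> R^o}) x :
  (forall y, `|T y| <= `|y|) -> differentiable T x.
Proof.
move=> T1; apply: linear_differentiable.
apply: bounded_linear_continuous; apply/linear_boundedP; exists 1.
split=> // r r1.
by move=> y; apply: (le_trans (T1 _)); rewrite ler_peMl // ltW.
Qed.

Lemma quadr_differentiable p x : differentiable (quadr p : plane R -> R^o) x.
Proof.
have d1 := contraction_differentiable (T := fst_plane) x (@normr_fst_le R).
have d2 := contraction_differentiable (T := snd_plane) x (@normr_snd_le R).
have -> : (quadr p : plane R -> R^o) =
    (p.1 / 2) *: fst_plane ^+ 2 + (p.2 / 2) *: snd_plane ^+ 2.
  by apply/funext => y; rewrite /quadr !fctE.
by apply: differentiableD; apply: differentiableZ; apply: differentiableX.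
Qed.

(** The defect of convexity of a quadratic form q at t x + (1 - t) y is
    t (1 - t) q (x - y). *)
Lemma quad_convex p : 0 <= p.1 -> 0 <= p.2 -> convex_fun (quad p).
Proof.
move=> p1 p2; apply: convex_fun_EFin => t x y /andP[t0 t1].
rewrite -subr_ge0.
have -> : t * quadr p x + (1 - t) * quadr p y -
    quadr p (t *: x + (1 - t) *: y) = t * (1 - t) * quadr p (x - y).
  by rewrite /quadr /= /GRing.scale /=; field.
rewrite mulr_ge0 // ?mulr_ge0 ?subr_ge0 // addr_ge0 //.
all: by rewrite mulr_ge0 ?sqr_ge0 ?divr_ge0.
Qed.

Lemma quad_pcc p : 0 <= p.1 -> 0 <= p.2 -> pcc (quad p).
Proof.
move=> p1 p2; split; [exact: proper_EFin| |exact: quad_convex].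
apply: closed_fun_EFin => x.
exact/differentiable_continuous/quadr_differentiable.
Qed.

Lemma half_normE x : 2^-1 * `|x| ^+ 2 = quadr (1, 1) x.
Proof. by rewrite -plane_innerxx /plane_inner /quadr /=; field. Qed.

Lemma half_scale_normE c x : c / 2 * `|x| ^+ 2 = quadr (c, c) x.
Proof. by rewrite -plane_innerxx /plane_inner /quadr /=; field. Qed.

Lemma quad_smooth beta p : 0 <= p.1 -> 0 <= p.2 -> p.1 <= beta -> p.2 <= beta ->
  smooth beta (quad p).
Proof.
move=> p1 p2 b1 b2; split.
  by exists (quadr p); split=> // x; exact: quadr_differentiable.
have -> : (fun x => (beta / 2 * `|x| ^+ 2)%:E - quad p x)%E =
    quad ((beta - p.1, beta - p.2) : plane R).
  apply/funext => x; rewrite half_scale_normE /quad -EFinB /quadr /=.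
  by congr EFin; field.
by apply: quad_convex; rewrite subr_ge0.
Qed.

Lemma quad_strongly_convex sigma p : sigma <= p.1 -> sigma <= p.2 ->
  strongly_convex sigma (quad p).
Proof.
move=> s1 s2; rewrite /strongly_convex.
have -> : (fun x => quad p x - (sigma / 2 * `|x| ^+ 2)%:E)%E =
    quad ((p.1 - sigma, p.2 - sigma) : plane R).
  apply/funext => x; rewrite half_scale_normE /quad -EFinB /quadr /=.
  by congr EFin; field.
by apply: quad_convex; rewrite subr_ge0.
Qed.

End quadratic.

(** * Conjugates and proximal maps *)

Section conjugate_prox.
Context (R : realType).
Implicit Types (p a x y z : plane R) (g : R).

Lemma quadr_gt0 p x : 0 < p.1 -> 0 < p.2 -> x != 0 -> 0 < quadr p x.
Proof.
move=> p1 p2 x0; have := normr_gt0 x; rewrite x0 => xgt0.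
have : 0 < x.1 ^+ 2 + x.2 ^+ 2.
  by rewrite !expr2 -innerE innerxx exprn_gt0.
have := sqr_ge0 x.1; have := sqr_ge0 x.2; rewrite /quadr.
move: (x.1 ^+ 2) (x.2 ^+ 2) => s t t0 s0 st.
have [s1|s1] := ltP 0 s.
  by rewrite ltr_wpDr ?mulr_ge0 ?mulr_gt0 ?divr_gt0 // ?divr_ge0 // ltW.
by rewrite ltr_wpDl ?mulr_ge0 ?mulr_gt0 ?divr_gt0 // ?divr_ge0 ?ltW //; lra.
Qed.

Lemma conjugate_quad p y : 0 < p.1 -> 0 < p.2 ->
  conjugate (quad p) y = quad ((p.1^-1, p.2^-1) : plane R) y.
Proof.
move=> p1 p2; apply/eqP; rewrite eq_le; apply/andP; split.
  apply: ge_ereal_sup => _ [x _ <-]; rewrite -EFinB lee_fin -subr_ge0.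
  (* the gap in the Fenchel-Young inequality is again a quadratic form *)
  have -> : quadr ((p.1^-1, p.2^-1) : plane R) y - (inner y x - quadr p x) =
    quadr p (x - (y.1 / p.1, y.2 / p.2)).
    by rewrite innerE /quadr /=; field; rewrite !gt_eqF.
  by rewrite addr_ge0 // mulr_ge0 ?sqr_ge0 ?divr_ge0 // ltW.
apply: ereal_sup_ubound; exists (y.1 / p.1, y.2 / p.2) => //.
by rewrite -EFinB; congr EFin; rewrite innerE /quadr /=; field; rewrite !gt_eqF.
Qed.

(** Away from the origin, x |-> <y, x> is unbounded along the ray spanned
    by y. *)
Lemma conjugate_cst0 (H : hilbertType R) :
  conjugate (fun _ : H => 0%E) = origin_indic.
Proof.
apply/funext => y; have [->|y0] := eqVneq y 0.
  rewrite origin_indic0; apply/eqP; rewrite eq_le; apply/andP; split.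
    apply: ge_ereal_sup => _ [x _ <-].
    by rewrite sube0 -(scale0r (0 : H)) innerZl mul0r.
  apply: ereal_sup_ubound; exists 0 => //.
  by rewrite sube0 -[X in inner X](scale0r (0 : H)) innerZl mul0r.
rewrite origin_indic_neq0 //; apply/eqyP => A A0.
have y2 : `|y| ^+ 2 != 0 by rewrite sqrf_eq0 normr_eq0.
apply: ereal_sup_ubound; exists ((A / `|y| ^+ 2) *: y) => //.
by rewrite sube0 innerC innerZl innerxx divfK.
Qed.

Lemma conjugate_origin_indic (H : hilbertType R) :
  conjugate (@origin_indic R H) = cst 0%E.
Proof.
have inner0 (y : H) : inner y 0 = 0.
  by rewrite innerC -[X in inner X](scale0r (0 : H)) innerZl mul0r.
apply/funext => y; apply/eqP; rewrite eq_le; apply/andP; split.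
  apply: ge_ereal_sup => _ [x _ <-]; have [->|x0] := eqVneq x 0.
    by rewrite inner0 origin_indic0 sube0.
  by rewrite origin_indic_neq0 //= leNye.
by apply: ereal_sup_ubound; exists 0 => //; rewrite inner0 origin_indic0 sube0.
Qed.

(** Completing the square: the displayed quotient minimises
    t |-> p/2 t^2 + g/2 (a t + w)^2, with the excess as third term. *)
Lemma penalised_sq_split (p g a w t : R) : 0 < p + g * a ^+ 2 ->
  p / 2 * (- (g * a * w) / (p + g * a ^+ 2)) ^+ 2 +
     g / 2 * (a * (- (g * a * w) / (p + g * a ^+ 2)) + w) ^+ 2 +
   (p + g * a ^+ 2) / 2 * (t - (- (g * a * w) / (p + g * a ^+ 2))) ^+ 2 =
  p / 2 * t ^+ 2 + g / 2 * (a * t + w) ^+ 2.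
Proof. by move=> /lt0r_neq0 s0; field. Qed.

Lemma prox_unique (H : hilbertType R) g (h : H -> \bar R) (z v : H) :
  (forall x : H, x != v ->
    (g%:E * h v + (2^-1 * `|v - z| ^+ 2)%:E <
    g%:E * h x + (2^-1 * `|x - z| ^+ 2)%:E)%E) ->
  prox g h z = v.
Proof.
move=> vmin; apply: xget_unique => [x|y yv].
  by have [->//|/vmin/ltW] := eqVneq x v.
by apply/eqP/negPn/negP => /vmin; rewrite ltNge yv.
Qed.

Lemma prox_cst0 (H : hilbertType R) g (z : H) : prox g (fun _ : H => 0%E) z = z.
Proof.
apply: prox_unique => x xz; rewrite mule0 !add0e lte_fin subrr normr0.
by rewrite expr0n mulr0 mulr_gt0 // exprn_gt0 // normr_gt0 subr_eq0.
Qed.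

Lemma prox_origin_indic (H : hilbertType R) g (z : H) : 0 < g ->
  prox g (@origin_indic R H) z = 0.
Proof.
move=> g0; apply: prox_unique => x x0.
rewrite origin_indic0 origin_indic_neq0 // mule0 add0e gt0_muley ?lte_fin //.
by rewrite addye // ltry.
Qed.

Lemma prox_quad p g z : 0 < g -> 0 <= p.1 -> 0 <= p.2 ->
  prox g (quad p) z = (z.1 / (1 + g * p.1), z.2 / (1 + g * p.2)).
Proof.
move=> g0 p1 p2.
have d1 : 0 < 1 + g * p.1 by rewrite ltr_wpDr // mulr_ge0 // ltW.
have d2 : 0 < 1 + g * p.2 by rewrite ltr_wpDr // mulr_ge0 // ltW.
set v : plane R := (_, _).
apply: prox_unique => x xv; rewrite /quad -!EFinM -!EFinD lte_fin !half_normE.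
rewrite -subr_gt0.
have -> : g * quadr p x + quadr (1, 1) (x - z) -
   (g * quadr p v + quadr (1, 1) (v - z)) =
   quadr (1 + g * p.1, 1 + g * p.2) (x - v).
  by rewrite /quadr /v /=; field; rewrite !gt_eqF.
by rewrite quadr_gt0 // subr_eq0.
Qed.

End conjugate_prox.

(** * Diagonal operators *)

Section diagonal.
Context (R : realType).
Implicit Types (p a x y z w mu : plane R) (g : R).

Definition diag a x : plane R := (a.1 * x.1, a.2 * x.2).

Lemma diag_linear a : linear (diag a).
Proof.
by move=> c x y; apply: plane_inj; rewrite /diag /= /GRing.scale /=; ring.
Qed.
HB.instance Definition _ a :=
  GRing.isLinear.Build R (plane R) (plane R) _ (diag a) (diag_linear a).

Lemma diag_norm_le a x : 0 <= a.2 <= a.1 -> `|diag a x| <= a.1 * `|x|.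
Proof.
move=> /andP[a0 a21]; have a10 : 0 <= a.1 by apply: le_trans a21.
rewrite -(@ler_pXn2r _ 2) ?nnegrE ?mulr_ge0 // exprMn -!innerxx !innerE /=.
rewrite -subr_ge0.
have -> : a.1 ^+ 2 * (x.1 * x.1 + x.2 * x.2) -
    (a.1 * x.1 * (a.1 * x.1) + a.2 * x.2 * (a.2 * x.2)) =
    (a.1 ^+ 2 - a.2 ^+ 2) * x.2 ^+ 2 by ring.
by rewrite mulr_ge0 ?sqr_ge0 // subr_ge0 ler_pXn2r ?nnegrE.
Qed.

Lemma diag_norm_ge a x : 0 <= a.2 <= a.1 -> a.2 * `|x| <= `|diag a x|.
Proof.
move=> /andP[a0 a21]; have a10 : 0 <= a.1 by apply: le_trans a21.
rewrite -(@ler_pXn2r _ 2) ?nnegrE ?mulr_ge0 // exprMn -!innerxx !innerE /=.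
rewrite -subr_ge0.
have -> : a.1 * x.1 * (a.1 * x.1) + a.2 * x.2 * (a.2 * x.2) -
    a.2 ^+ 2 * (x.1 * x.1 + x.2 * x.2) =
    (a.1 ^+ 2 - a.2 ^+ 2) * x.1 ^+ 2 by ring.
by rewrite mulr_ge0 ?sqr_ge0 // subr_ge0 ler_pXn2r ?nnegrE.
Qed.

Lemma opnorm_diag a : 0 <= a.2 <= a.1 -> opnorm (diag a) = a.1.
Proof.
move=> a21; have a10 : 0 <= a.1 by case/andP: a21; apply: le_trans.
have e1 : `|(1, 0) : plane R| = 1.
  apply/eqP; rewrite -(@eqrXn2 _ 2) // expr1n -innerxx innerE /=.
  by apply/eqP; ring.
have De1 : `|diag a (1, 0)| = a.1.
  have -> : diag a (1, 0) = a.1 *: ((1, 0) : plane R).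
    by apply: plane_inj; rewrite /diag /= /GRing.scale /= ?mulr0 ?mulr1.
  by rewrite normrZ e1 mulr1 ger0_norm.
have ub : ubound [set `|diag a x| | x in [set x : plane R | `|x| <= 1]] a.1.
  move=> _ [x /= x1 <-]; apply: (le_trans (diag_norm_le _ a21)).
  by rewrite ler_piMr.
have att : [set `|diag a x| | x in [set x : plane R | `|x| <= 1]] a.1.
  by exists (1, 0); rewrite //= e1.
apply/eqP; rewrite eq_le; apply/andP; split.
  by apply: ge_sup => //; exists a.1.
by apply: ub_le_sup => //; exists a.1.
Qed.

Lemma adjoint_unique (H K : hilbertType R) (T : H -> K) (mu : K) (v : H) :
  (forall x : H, inner (T x) mu = inner x v) -> adjoint T mu = v.
Proof.
move=> Tv; apply: xget_unique => // w Tw.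
apply/eqP; rewrite -subr_eq0 -normr_eq0 -sqrf_eq0 -innerxx.
have innerBr (x y1 y2 : H) : inner x (y1 - y2) = inner x y1 - inner x y2.
  by rewrite innerC innerDl -scaleN1r innerZl mulN1r !(innerC _ x).
by rewrite innerBr -Tw -Tv subrr.
Qed.

Lemma adjoint_diag a : adjoint (diag a) = diag a.
Proof.
by apply/funext => mu; apply: adjoint_unique => x; rewrite !innerE /=; ring.
Qed.

Lemma adjoint_id (H : hilbertType R) : adjoint (idfun : H -> H) = id.
Proof. by apply/funext => mu; apply: adjoint_unique. Qed.

Lemma argmin_quad_penalised p a w g : 0 <= g -> 0 < p.1 -> 0 < p.2 ->
  argmin (fun v => quad p v + (g / 2 * `|diag a v + w| ^+ 2)%:E)%E
    (- (g * a.1 * w.1) / (p.1 + g * a.1 ^+ 2),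
     - (g * a.2 * w.2) / (p.2 + g * a.2 ^+ 2)).
Proof.
move=> g0 p1 p2 v; rewrite /quad -!EFinD lee_fin !half_scale_normE.
have s1 : 0 < p.1 + g * a.1 ^+ 2 by rewrite ltr_wpDr // mulr_ge0 ?sqr_ge0.
have s2 : 0 < p.2 + g * a.2 ^+ 2 by rewrite ltr_wpDr // mulr_ge0 ?sqr_ge0.
have := penalised_sq_split w.1 v.1 s1.
have := penalised_sq_split w.2 v.2 s2.
rewrite /quadr /=.
set m1 := _ / (p.1 + _); set m2 := _ / (p.2 + _).
have q1 : 0 <= (p.1 + g * a.1 ^+ 2) / 2 * (v.1 - m1) ^+ 2.
  by rewrite mulr_ge0 ?sqr_ge0 ?divr_ge0 // ltW.
have q2 : 0 <= (p.2 + g * a.2 ^+ 2) / 2 * (v.2 - m2) ^+ 2.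
  by rewrite mulr_ge0 ?sqr_ge0 ?divr_ge0 // ltW.
lra.
Qed.

End diagonal.

(** * The problem attaining the worst case, and its reflections *)

Section witness.
Context (R : realType) (sigma beta theta zeta gamma : R).
Hypotheses (sigma_gt0 : 0 < sigma) (sigma_le_beta : sigma <= beta)
  (theta_gt0 : 0 < theta) (theta_le_zeta : theta <= zeta)
  (gamma_gt0 : 0 < gamma).

Let beta_gt0 : 0 < beta. Proof. exact: lt_le_trans sigma_le_beta. Qed.
Let zeta_gt0 : 0 < zeta. Proof. exact: lt_le_trans theta_le_zeta. Qed.

(** The boolean is the sign of R_{gamma d_2}, positive for [true]. *)
Definition witness_g (b : bool) : plane R -> \bar R :=
  if b then origin_indic else fun=> 0%E.

Definition witness (b : bool) : problem R :=
  @Problem R (plane R) (plane R) (plane R)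
    (quad (sigma, beta)) (witness_g b) (diag (zeta, theta)) idfun 0.

Lemma d1_witness b :
  @d1 R (witness b) = quad (zeta ^+ 2 / sigma, theta ^+ 2 / beta).
Proof.
apply/funext => mu; rewrite /d1 /= adjoint_diag conjugate_quad //.
rewrite /quad -EFinD innerE /quadr /diag /=; congr EFin; field.
by rewrite !gt_eqF.
Qed.

Lemma d2_witness b : @d2 R (witness b) = witness_g (~~ b).
Proof.
apply/funext => mu; rewrite /d2; case: b mu => mu /=; rewrite adjoint_id.
  by rewrite conjugate_origin_indic.
by rewrite conjugate_cst0 /origin_indic oppr_eq0.
Qed.

Lemma pcc_cst0 : pcc (fun _ : plane R => 0%E).
Proof.
have -> : (fun _ : plane R => 0%E) = quad (0, 0).
  by apply/funext => x; rewrite /quad /quadr /= !mul0r addr0.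
exact: quad_pcc.
Qed.

Lemma witness_in_class b : problem_class sigma beta theta zeta (witness b).
Proof.
have a21 : 0 <= ((zeta, theta) : plane R).2 <= ((zeta, theta) : plane R).1.
  by rewrite /= theta_le_zeta ltW.
have pcc_g c : pcc (witness_g c).
  by case: c; [exact: pcc_origin_indic|exact: pcc_cst0].
split => /=.
- split=> //.
  + by apply: quad_pcc; apply: ltW.
  + by apply: quad_smooth => //=; apply: ltW.
  + exact: quad_strongly_convex.
- split; first by exists zeta => x; apply: diag_norm_le.
  by exists 1 => x; rewrite mul1r.
- rewrite adjoint_diag; split=> [mu||mu].
  + exists (mu.1 / zeta, mu.2 / theta).
    by apply: plane_inj => /=; field; rewrite gt_eqF.
  + exact: (opnorm_diag a21).
  + exact: (diag_norm_ge _ a21).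
- rewrite d1_witness d2_witness; split; last exact: pcc_g.
  by apply: quad_pcc; rewrite /= divr_ge0 ?sqr_ge0 // ltW.
Qed.

(** The ratio by which the reflected proximal map of t/2 |.|^2 scales. *)
Definition reflection_coef (t : R) : R := (1 - t) / (1 + t).

(** The eigenvalues of R_{gamma d_1}. *)
Definition kappa : plane R :=
  (reflection_coef (gamma * (zeta ^+ 2 / sigma)),
   reflection_coef (gamma * (theta ^+ 2 / beta))).

Definition sign (b : bool) : R := if b then 1 else -1.

Lemma curvature_gt0 :
  0 < gamma * (zeta ^+ 2 / sigma) /\
  0 < gamma * (theta ^+ 2 / beta).
Proof. by split; rewrite mulr_gt0 // divr_gt0 // exprn_gt0. Qed.

(** The reflection of a quadratic form of curvature h has coefficient
    2 / (1 + gamma h) - 1 = (1 - gamma h) / (1 + gamma h). *)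
Lemma RR_witness b z : @RR R gamma (witness b) z = sign b *: diag kappa z.
Proof.
rewrite /RR d1_witness d2_witness.
have -> : reflected_prox gamma (witness_g (~~ b)) z = sign b *: z.
  rewrite /reflected_prox /witness_g /sign; case: b z => z /=.
    by rewrite prox_cst0 scale1r scaler_nat mulr2n addrK.
  by rewrite prox_origin_indic // scaler0 sub0r scaleN1r.
have [t1 t2] := curvature_gt0.
have h1 : 0 <= zeta ^+ 2 / sigma by rewrite divr_ge0 ?sqr_ge0 // ltW.
have h2 : 0 <= theta ^+ 2 / beta by rewrite divr_ge0 ?sqr_ge0 // ltW.
rewrite /reflected_prox prox_quad //=.
have n1 : 1 + gamma * (zeta ^+ 2 / sigma) != 0 by rewrite gt_eqF // addr_gt0.
have n2 : 1 + gamma * (theta ^+ 2 / beta) != 0 by rewrite gt_eqF // addr_gt0.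
apply: plane_inj; rewrite /diag /kappa /reflection_coef /= /GRing.scale /=.
  by move: (gamma * (zeta ^+ 2 / sigma)) n1 => t n1; field.
by move: (gamma * (theta ^+ 2 / beta)) n2 => t n2; field.
Qed.

(** Only u - B y is determined by z, and the x-update sees z through y + u.
    For g = 0 the y-update minimises a squared residual to zero, so u = 0 from
    the first step on; for g the indicator of the origin, y = 0. In both cases
    y + u is z / gamma up to the sign of R_{gamma d_2}, which is how that
    reflection enters the x-update. *)
Lemma admm_run_witness alpha b z :
  @z_iteration R alpha gamma (witness b) z ->
  @admm_run R alpha gamma (witness b) z.
Proof.
move=> zit.
pose ginv := gamma^-1.
pose y k : plane R := if b then 0 else - ginv *: z k.
pose u k : plane R := if b then ginv *: z k else 0.
have yuE k : (y k : plane R) + u k = (sign b * ginv) *: (z k : plane R).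
  rewrite /y /u /sign; case: (b); first by rewrite add0r mul1r.
  by rewrite addr0 mulN1r.
pose w k : plane R := y k + u k.
pose x k : plane R := if k is k'.+1 then
  (- (gamma * zeta * (w k').1) / (sigma + gamma * zeta ^+ 2),
   - (gamma * theta * (w k').2) / (beta + gamma * theta ^+ 2)) else 0.
exists x, y, u; split; last first.
  move=> k /=; rewrite /y /u; case: (b).
    by rewrite subr0 scalerA divff ?gt_eqF // scale1r.
  by rewrite sub0r scaleNr opprK scalerA divff ?gt_eqF // scale1r.
move=> k xA.
have n1 : sigma + gamma * zeta ^+ 2 != 0.
  by rewrite gt_eqF // addr_gt0 // mulr_gt0 // exprn_gt0.
have n2 : beta + gamma * theta ^+ 2 != 0.
  by rewrite gt_eqF // addr_gt0 // mulr_gt0 // exprn_gt0.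
have u_step : u k.+1 = u k + (xA + y k.+1).
  rewrite /xA /x /w yuE /y /u /= subr0 zit RR_witness.
  rewrite /kappa /reflection_coef /ginv /sign.
  move: (z k : plane R) => v; rewrite /diag.
  by case: (b); apply: plane_inj; rewrite /= /GRing.scale /=; field;
    rewrite ?n1 ?n2 !gt_eqF.
split => /=.
- have -> : (fun v => quad (sigma, beta) v +
     (gamma / 2 * `|diag (zeta, theta) v + y k - 0 + u k| ^+ 2)%:E)%E =
    (fun v => quad (sigma, beta) v +
     (gamma / 2 * `|diag (zeta, theta) v + w k| ^+ 2)%:E)%E.
    by apply/funext => v; rewrite subr0 addrA.
  apply: (argmin_quad_penalised (p := (sigma, beta)) (zeta, theta)) => //=.
  exact: ltW.
- move=> v; rewrite !subr0 /witness_g.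
  move: u_step; rewrite /u /y; case: (b) => /= u_step.
    have [->//|v0] := eqVneq v 0.
    by rewrite (origin_indic_neq0 v0) addye ?ltNyr // leey.
  rewrite !add0e lee_fin.
  set yk := - ginv *: z k.+1; move: u_step.
  rewrite add0r addr0 => <-; rewrite normr0 expr0n mulr0.
  by rewrite mulr_ge0 ?sqr_ge0 // divr_ge0 // ltW.
- by rewrite subr0.
Qed.

End witness.

(** * Geometric orbits *)

Section geometric.
Context (R : realType).
Implicit Types t r : R.

Lemma reflection_coef_lt1 t : 0 < t -> `|reflection_coef t| < 1.
Proof.
move=> t0; rewrite /reflection_coef ltr_norml ltr_pdivrMr ?ltr_pdivlMr; lra.
Qed.

Lemma reflection_coef_le t r : 0 < t -> t <= r ->
  reflection_coef r <= reflection_coef t.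
Proof.
move=> t0 tr; rewrite /reflection_coef ler_pdivrMr ?addr_gt0 //; last lra.
rewrite mulrAC ler_pdivlMr; last lra.
lra.
Qed.

Lemma geometric_not_cvg0 (V : normedModType R) (rho : R) (e : V) :
  1 <= `|rho| -> e != 0 -> ~ ((fun k => rho ^+ k *: e) @ \oo --> (0 : V)).
Proof.
move=> rho1 e0 /cvgrPdist_lt/(_ `|e|); rewrite normr_gt0 => /(_ e0).
move=> [N _ /(_ N (leqnn N))].
by rewrite /= sub0r normrN normrZ normrX gtr_pMl ?normr_gt0 // ltNge exprn_ege1.
Qed.

End geometric.

Section witness_orbits.
Context (R : realType) (sigma beta theta zeta gamma : R).
Hypotheses (sigma_gt0 : 0 < sigma) (sigma_le_beta : sigma <= beta)
  (theta_gt0 : 0 < theta) (theta_le_zeta : theta <= zeta)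
  (gamma_gt0 : 0 < gamma).

Let kap := kappa sigma beta theta zeta gamma.
Let P := witness sigma beta theta zeta.
Definition delta := Num.max (- kap.1) kap.2.

Let curv :=
  curvature_gt0 sigma_gt0 sigma_le_beta theta_gt0 theta_le_zeta gamma_gt0.

Lemma delta_lt1 : delta < 1.
Proof.
have [/reflection_coef_lt1 t1 /reflection_coef_lt1 t2] := curv.
move: t1 t2; rewrite /delta gt_max /kap /kappa /= !ltr_norml.
by move=> /andP[? ?] /andP[? ?]; apply/andP; split; lra.
Qed.

(** Since sigmahat <= betahat, kappa_1 <= kappa_2: they cannot satisfy
    kappa_2 < 0 < kappa_1. *)
Lemma delta_ge0 : 0 <= delta.
Proof.
have [t1 t2] := curv.
have beta_gt0 : 0 < beta := lt_le_trans sigma_gt0 sigma_le_beta.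
have : kap.1 <= kap.2.
  apply: reflection_coef_le => //; rewrite ler_pM2l //.
  apply: ler_pM; rewrite ?sqr_ge0 ?invr_ge0 ?(ltW sigma_gt0) //.
  - exact: ltW beta_gt0.
  - have zeta_gt0 := lt_le_trans theta_gt0 theta_le_zeta.
    by rewrite ler_pXn2r ?nnegrE ?(ltW theta_gt0) ?(ltW zeta_gt0).
  - by rewrite lef_pV2 ?posrE.
rewrite /delta le_max.
by case: (leP kap.1 0) => [k0 _|k0 k12]; apply/orP; [left|right]; lra.
Qed.

Lemma fixed_point_witness b z : @fixed_point R gamma (P b) z <-> z = 0.
Proof.
rewrite /fixed_point RR_witness //; split=> [zfix|->]; last first.
  by rewrite linear0 scaler0.
have [/reflection_coef_lt1 t1 /reflection_coef_lt1 t2] := curv.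
move: t1 t2; rewrite !ltr_norml => t1 t2.
have coord (r c : R) : -1 < r < 1 -> sign R b * (r * c) = c -> c = 0.
  move=> r1 rc; suff : (1 - sign R b * r) * c = 0.
    move/eqP; rewrite mulf_eq0 => /orP[|/eqP//].
    by rewrite gt_eqF // /sign; case: (b); lra.
  by rewrite mulrBl mul1r -mulrA rc subrr.
by apply: plane_inj; [apply: coord t1 _|apply: coord t2 _];
  rewrite -[in RHS]zfix.
Qed.

(** An eigenvector for -kappa_1 or kappa_2, whichever is deltahat: the first
    basis vector needs the opposite of the wanted sign. *)
Lemma geometric_run alpha s : exists b (e : plane R), e != 0 /\
  @z_iteration R alpha gamma (P b)
    (fun k => (1 - alpha + alpha * (sign R s * delta)) ^+ k *: e).
Proof.
suff [b [e [e0 eigen]]] : exists b (e : plane R), e != 0 /\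
    sign R b *: diag kap e = (sign R s * delta) *: e.
  exists b, e; split=> // k; rewrite RR_witness // exprS.
  set c := _ ^+ k.
  have -> : diag kap (c *: e) = c *: diag kap e by exact: linearZ.
  rewrite [sign R b *: _]scalerA [sign R b * c]mulrC -[(c * _) *: _]scalerA.
  rewrite eigen !scalerA -scalerDl.
  by congr (_ *: _); ring.
have [d1|d2] : delta = - kap.1 \/ delta = kap.2.
  by rewrite /delta; case: leP; [right|left].
- exists (~~ s), (1, 0); split; first by apply/eqP => -[/eqP]; rewrite oner_eq0.
  rewrite d1 /sign.
  by case: (s); apply: plane_inj; rewrite /= /GRing.scale /=; ring.
- exists s, (0, 1); split; first by apply/eqP => -[/eqP]; rewrite oner_eq0.
  rewrite d2 /sign.
  by case: (s); apply: plane_inj; rewrite /= /GRing.scale /=; ring.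
Qed.

End witness_orbits.

Unset Implicit Arguments.

Theorem corollary3 (R : realType) (sigma beta theta zeta gamma : R)
    (sigma_gt0 : 0 < sigma) (sigma_le_beta : sigma <= beta)
    (theta_gt0 : 0 < theta) (theta_le_zeta : theta <= zeta)
    (gamma_gt0 : 0 < gamma) :
  let betahat := zeta ^+ 2 / sigma in
  let sigmahat := theta ^+ 2 / beta in
  let deltahat := Num.max
    ((gamma * betahat - 1) / (1 + gamma * betahat))
    ((1 - gamma * sigmahat) / (1 + gamma * sigmahat)) in
  (forall alpha : R, 0 < alpha < 2 / (1 + deltahat) ->
    exists P : problem R, problem_class sigma beta theta zeta P /\
    exists (zbar : spaceK P) (z : nat -> spaceK P),
      [/\ fixed_point gamma zbar,
          z_iteration alpha gamma z, admm_run alpha gamma z,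
          z 0%N != zbar
        & forall k, `|z k.+1 - zbar| =
            (`|1 - alpha| + alpha * deltahat) * `|z k - zbar|])
  /\
  (forall alpha : R, ~~ (0 < alpha < 2 / (1 + deltahat)) ->
    exists P : problem R, problem_class sigma beta theta zeta P /\
    exists z : nat -> spaceK P,
      [/\ z_iteration alpha gamma z, admm_run alpha gamma z
        & ~ (exists zbar : spaceK P, fixed_point gamma zbar /\ z @ \oo --> zbar)]).
Proof.
move=> betahat sigmahat deltahat.
have dE : deltahat = delta sigma beta theta zeta gamma.
  rewrite /deltahat /delta /kappa /reflection_coef /=; congr (Num.max _ _).
  by rewrite -[RHS]mulNr opprB.
have d0 : 0 <= deltahat by rewrite dE delta_ge0.
have d1 : deltahat < 1 by rewrite dE delta_lt1.
have class := witness_in_class sigma_gt0 sigma_le_beta theta_gt0 theta_le_zeta.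
split=> alpha.
- move=> /andP[alpha0 _].
  (* the sign for which 1 - alpha and the deltahat term do not cancel *)
  have [b [e [e0 zit]]] := geometric_run sigma_gt0 sigma_le_beta theta_gt0
    theta_le_zeta gamma_gt0 alpha (alpha <= 1).
  exists (witness sigma beta theta zeta b); split; first exact: class.
  exists 0, (fun k =>
    (1 - alpha + alpha * (sign R (alpha <= 1) * deltahat)) ^+ k *: e).
  rewrite -dE in zit; split=> //.
  + exact/fixed_point_witness.
  + exact: admm_run_witness.
  + by rewrite expr0 scale1r.
  + move=> k; rewrite !subr0 exprS -scalerA normrZ; congr (_ * _).
    have ad0 : 0 <= alpha * deltahat by rewrite mulr_ge0 // ltW.
    rewrite /sign; case: leP => a1.
      by rewrite mul1r !ger0_norm; lra.
    by rewrite mulN1r mulrN !ltr0_norm; lra.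
- move=> alphaN.
  have [b [e [e0 zit]]] := geometric_run sigma_gt0 sigma_le_beta theta_gt0
    theta_le_zeta gamma_gt0 alpha (alpha <= 0).
  exists (witness sigma beta theta zeta b); split; first exact: class.
  exists (fun k =>
    (1 - alpha + alpha * (sign R (alpha <= 0) * deltahat)) ^+ k *: e).
  rewrite -dE in zit; split=> //; first exact: admm_run_witness.
  move=> [zbar [/fixed_point_witness zbar0]]; rewrite zbar0 //.
  apply: geometric_not_cvg0 => //.
  move: alphaN; rewrite negb_and -!leNgt /sign; case: leP => /= a0.
    move=> _; rewrite mul1r ler_normr; apply/orP; left.
    have : 0 <= - alpha * (1 - deltahat) by rewrite mulr_ge0; lra.
    lra.
  rewrite ler_pdivrMr; last lra.
  by move=> a2; rewrite ler_normr; apply/orP; right; lra.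
Qed.
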